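(* Let $m\ge 1$, $0<\rho<1$, and let $S_j(x)=\rho x+d_j$, $j=0,\dots,m$, where $0=d_0<d_1<\dots<d_m=1-\rho$ and $d_j-d_{j-1}\le\rho$ for all $j=1,\dots,m$. Let $p_0,\dots,p_m>0$ with $\sum_{j=0}^m p_j=1$, and let $\mu$ be the associated self-similar measure (which has support $[0,1]$). Let $I\subset[0,1]$ be an open interval such that for every $x\in(0,1)$ there exists a finite word $\sigma$ on the alphabet $\{0,1,\dots,m\}$ with $x\in S_\sigma(I)$. Let $n\ge1$ be an integer and let $k=\min_{x\in I}\mathcal{N}_n(x,I)$. Then for all $x\in(0,1)$, $$\overline{\dim}_{\mathrm{loc}}\,\mu(x)\le\frac{\log k}{n\log\rho}.$$
   Context: The self-similar measure associated with $(S_j,p_j)$ is the unique Borel probability measure $\mu$ satisfying $\mu=\sum_{j=0}^m p_j\cdot\mu\circ S_j^{-1}$. Let $\mathcal{A}=\{0,1,\dots,m\}$. For a word $\sigma=(\sigma_1,\dots,\sigma_n)\in\mathcal{A}^n$ put $S_\sigma=S_{\sigma_1}\circ\dots\circ S_{\sigma_n}$ and $p_\sigma=p_{\sigma_1}\cdots p_{\sigma_n}$. For $x\in[0,1]$ and $I\subset[0,1]$ define $\mathcal{E}_n(x,I)=\{\sigma\in\mathcal{A}^n:x\in S_\sigma(I)\}$ and $\mathcal{N}_n(x,I)=\sum_{\sigma\in\mathcal{E}_n(x,I)}p_\sigma$. The upper local dimension of $\mu$ at $x\in\operatorname{supp}\mu$ is $\overline{\dim}_{\mathrm{loc}}\,\mu(x)=\limsup_{\epsilon\to0^+}\frac{\log\mu([x-\epsilon,x+\epsilon])}{\log\epsilon}$.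 If $k=0$ the bound is interpreted as $+\infty$ (a trivial bound). *)

(* Defs.v *)
From HB Require Import structures.
From mathcomp Require Import all_boot all_order all_algebra.
From mathcomp Require Import all_classical all_reals all_analysis.
Set Implicit Arguments.
Unset Strict Implicit.
Unset Printing Implicit Defensive.
Import Order.TTheory GRing.Theory Num.Theory.
Import numFieldNormedType.Exports.
Local Open Scope classical_set_scope.
Local Open Scope ring_scope.

Definition sim (R : realType) (m : nat) (rho : R) (d : 'I_m.+1 -> R)
    (j : 'I_m.+1) (x : R) : R :=
  rho * x + d j.

(* S_(s_1, ..., s_n) = S_(s_1) \o ... \o S_(s_n); the empty word gives the
   identity. *)
Definition sim_word (R : realType) (m : nat) (rho : R) (d : 'I_m.+1 -> R)
    (s : seq 'I_m.+1) (x : R) : R :=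
  foldr (sim rho d) x s.

Definition weight (R : realType) (m : nat) (p : 'I_m.+1 -> R)
    (s : seq 'I_m.+1) : R :=
  \prod_(j <- s) p j.

Definition self_similar (R : realType) (m : nat) (rho : R)
    (d p : 'I_m.+1 -> R) (mu : probability (measurableTypeR R) R) : Prop :=
  forall A : set (measurableTypeR R), measurable A ->
    mu A = (\sum_(j < m.+1) (p j)%:E * mu (sim rho d j @^-1` A))%E.

Definition words (R : realType) (m : nat) (rho : R) (d : 'I_m.+1 -> R)
    (n : nat) (x : R) (I : set R) : {set n.-tuple 'I_m.+1} :=
  [set s : n.-tuple 'I_m.+1 | `[< (sim_word rho d s @` I) x >] ]%SET.

Definition words_mass (R : realType) (m : nat) (rho : R)
    (d p : 'I_m.+1 -> R) (n : nat) (x : R) (I : set R) : R :=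
  \sum_(s in words rho d n x I) weight p s.

Definition is_minimum (R : realType) (A : set R) (k : R) : Prop :=
  A k /\ lbound A k.

(* The logarithm is [lne], with lne 0 = -oo: dividing by a negative real gives
   +oo, so a null interval would contribute the ratio +oo for e < 1, and a
   bound of the form lne 0 / (n * ln rho) with 0 < rho < 1 is the trivial +oo. *)
Definition upper_local_dim (R : realType)
    (mu : probability (measurableTypeR R) R) (x : R) : \bar R :=
  limf_esup (fun e : R => (lne (mu `[(x - e)%R, (x + e)%R]%classic) / (ln e)%:E)%E) 0^'+.

(* [words_mass] takes only finitely many values, so its minimum over a
   nonempty set is attained. *)
Lemma words_mass_minimum (R : realType) (m : nat) (rho : R)
    (d p : 'I_m.+1 -> R) (n : nat) (I : set R) :
  I !=set0 ->
  exists k, is_minimum [set words_mass rho d p n x I | x in I] k.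
Proof.
move=> [x0 Ix0].
pose v (E : {set n.-tuple 'I_m.+1}) : R := \sum_(s in E) weight p s.
pose P (E : {set n.-tuple 'I_m.+1}) :=
  `[< exists2 x, I x & words rho d n x I = E >].
have P0 : P (words rho d n x0 I) by apply/asboolP; exists x0.
case: (Order.TotalTheory.arg_minP v P0) => E /asboolP[x Ix xE] minE.
exists (v E); split; first by exists x => //; rewrite -xE.
by move=> _ [y Iy <-]; apply: minE; apply/asboolP; exists y.
Qed.

(* Main.v *)
Require Import Defs.
From HB Require Import structures.
From mathcomp Require Import all_boot all_order all_algebra.
From mathcomp Require Import all_classical all_reals all_analysis.
From mathcomp Require Import measurable_realfun ring lra.
Import Order.TTheory GRing.Theory Num.Theory.
Import numFieldNormedType.Exports.
Local Open Scope classical_set_scope.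
Local Open Scope ring_scope.

(** Fix [t] with [c := mu `[-t, t]] positive, so that [mu `[y - r, y + r] >= c]
for all [y] in [I] and [r >= 2t]. If [mu `[y - r, y + r] >= c'] for all [y] in
[I], then [mu `[y - rho^n r, y + rho^n r] >= k c'] for all [y] in [I]: each of
the words [s] counted by [N_n(y, I)] pulls [y] back to a point of [I], and their
total weight is at least [k]. Iterating, an interval of radius [~ rho^(nN)]
around a point of [I] has mass at least [c k^N]. A point [x] of (0, 1) is
[S_s y] for some word [s] and some [y] in [I], which costs only constants, so
[ln (mu `[x - e, x + e])] is at least [O(1) + ln e * ln k / (n ln rho)]. *)

Lemma sim_wordB (R : realType) (m : nat) (rho : R) (d : 'I_m.+1 -> R)
    (s : seq 'I_m.+1) (y z : R) :
  sim_word rho d s y - sim_word rho d s z = rho ^+ size s * (y - z).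
Proof.
elim: s => [|j s IHs]; first by rewrite mul1r.
rewrite /= /sim opprD addrACA subrr addr0 -mulrBr.
by rewrite -/(sim_word rho d s _) IHs exprS mulrA.
Qed.

(** [sim_word rho d s] multiplies distances by [rho ^+ n], so membership in either interval amounts
    to the same bound on [|w - y|]. *)
Lemma sim_word_preimage_itv (R : realType) (m : nat) (rho : R)
    (d : 'I_m.+1 -> R) (n : nat) (s : n.-tuple 'I_m.+1) (y r : R) : 0 < rho ->
  let z := sim_word rho d s y in
  sim_word rho d s @^-1`
    `[z - rho ^+ n * r, z + rho ^+ n * r]%classic = `[y - r, y + r]%classic.
Proof.
move=> rho0 z; apply/seteqP; have q0 : 0 < rho ^+ n by rewrite exprn_gt0.
have E w : (z - rho ^+ n * r <= sim_word rho d s w <= z + rho ^+ n * r) =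
           (y - r <= w <= y + r).
  by rewrite -!ler_distl sim_wordB size_tuple normrM gtr0_norm// ler_pM2l.
by split=> w /=; rewrite !in_itv /= E.
Qed.

Lemma measurable_sim (R : realType) (m : nat) (rho : R) (d : 'I_m.+1 -> R)
    (j : 'I_m.+1) : measurable_fun setT (sim rho d j).
Proof.
apply: measurable_funD; last exact: measurable_cst.
exact: measurable_funM.
Qed.

Lemma self_similar_iter (R : realType) (m : nat) (rho : R)
    (d p : 'I_m.+1 -> R) (mu : probability (measurableTypeR R) R) :
  (forall j, 0 < p j) -> self_similar rho d p mu ->
  forall n (A : set (measurableTypeR R)), measurable A ->
  mu A = (\sum_(s : n.-tuple 'I_m.+1)
            (weight p s)%:E * mu (sim_word rho d s @^-1` A))%E.
Proof.
move=> p0 ss; elim=> [|n IHn] A mA.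
  rewrite (big_pred1 [tuple]); last first.
    by move=> s; rewrite (tuple0 s); exact/esym/eqP.
  by rewrite /weight big_nil mul1e.
have mAj j : measurable (sim rho d j @^-1` A : set (measurableTypeR R)).
  by rewrite -[X in measurable X]setTI; exact: measurable_sim.
have w0 (t : n.-tuple 'I_m.+1) : 0 <= weight p t.
  by apply: prodr_ge0 => i _; exact/ltW.
transitivity (\sum_(j < m.+1) \sum_(t : n.-tuple 'I_m.+1)
    (p j)%:E * ((weight p t)%:E *
      mu (sim_word rho d t @^-1` (sim rho d j @^-1` A))))%E.
  rewrite ss//; apply: eq_bigr => j _.
  rewrite (IHn _ (mAj j)) ge0_sume_distrr// => t _.
  by rewrite mule_ge0 ?lee_fin.
(* Words of length [n.+1] are pairs of a first letter and a tail; the first letter is the outermost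
   map, so its preimage is taken first. *)
rewrite pair_bigA /= (reindex (fun u => cons_tuple u.1 u.2)) /=; last first.
  exists (fun t => (thead t, behead_tuple t)) => [[j t] _|t _] /=.
    by congr pair; exact: val_inj.
  by rewrite [RHS]tuple_eta; exact: val_inj.
by apply: eq_bigr => -[j t] _; rewrite /weight big_cons EFinM muleA.
Qed.

(** The line is a countable union of such intervals, so they cannot all be null. The bound [1 <= t]
    makes every interval of radius at least [t + t] around a point of [0, 1] contain [[- t, t]]. *)
Lemma exists_itv_measure_gt0 (R : realType)
    (mu : probability (measurableTypeR R) R) :
  exists2 t : R, 1 <= t & (0 < mu `[(- t)%R, t]%classic)%E.
Proof.
apply: contrapT => H.
have null k : mu.-negligible (`[- k.+1%:R, k.+1%:R]%classic : set R).
  exists `[- k.+1%:R, k.+1%:R]%classic; split => //.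
  apply/eqP; rewrite -measure_le0 leNgt; apply/negP => gt0.
  by apply: H; exists k.+1%:R => //; rewrite ler1n.
have /negligibleP : mu.-negligible (setT : set (measurableTypeR R)).
  apply: negligibleS (negligible_bigcup null) => x _.
  exists (Num.truncn `|x|) => //=.
  by rewrite in_itv /= -ler_norml ltW// truncnS_gt.
move=> /(_ measurableT) mu0.
by have /eqP := probability_setT mu; rewrite mu0 eq_sym onee_eq0.
Qed.

(** Induction on [N]; the bound is kept uniform over the centres in [I] because each step moves the
    centre to other points of [I]. *)
Lemma self_similar_itv_ge (R : realType) (m : nat) (rho : R)
    (d p : 'I_m.+1 -> R) (mu : probability (measurableTypeR R) R)
    (I : set R) (n : nat) (k c t : R) :
  0 < rho -> (forall j, 0 < p j) -> self_similar rho d p mu ->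
  0 <= k -> 0 <= c ->
  (forall x, I x -> k <= words_mass rho d p n x I) ->
  (forall x r, I x -> t <= r ->
     (c%:E <= mu `[(x - r)%R, (x + r)%R]%classic)%E) ->
  forall N x r, I x -> t <= r ->
  ((c * k ^+ N)%:E
     <= mu `[(x - (rho ^+ n) ^+ N * r)%R,
             (x + (rho ^+ n) ^+ N * r)%R]%classic)%E.
Proof.
move=> rho0 p0 ss k0 c0 kI cI; elim=> [|N IHN] x r Ix tr.
  by rewrite !expr0 mulr1 !mul1r; exact: cI.
have w0 (s : n.-tuple 'I_m.+1) : 0 <= weight p s.
  by apply: prodr_ge0 => i _; exact/ltW.
rewrite (self_similar_iter _ _ _ _ _ _ p0 ss n)//.
apply: (@le_trans _ _ (\sum_(s in words rho d n x I)
    (weight p s * (c * k ^+ N))%:E)%E).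
  rewrite sumEFin lee_fin -mulr_suml exprS mulrCA.
  by rewrite ler_wpM2r ?mulr_ge0 ?exprn_ge0//; exact: kI.
rewrite [leRHS](bigID (mem (words rho d n x I))) /=.
rewrite -[leLHS]adde0; apply: leeD; last first.
  by apply: sume_ge0 => s _; rewrite mule_ge0// lee_fin.
apply: lee_sum => s; rewrite inE => /asboolP[y Iy <-].
rewrite EFinM lee_wpmul2l ?lee_fin//.
rewrite exprS -mulrA sim_word_preimage_itv//.
exact: IHN.
Qed.

(** With [N] about [ln (e / t) / ln q], the logarithm of the mass is at least
    [K + ln e * (ln k / ln q)], where [K] does not depend on [e]. Division by [ln e], which is
    negative and tends to -oo, leaves [ln k / ln q] plus a vanishing term. *)
Lemma upper_local_dim_le (R : realType)
    (mu : probability (measurableTypeR R) R) (x C t k q : R) :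
  0 < C -> 0 < t -> 0 < k <= 1 -> 0 < q < 1 ->
  (forall N e, q ^+ N * t <= e ->
     ((C * k ^+ N)%:E <= mu `[(x - e)%R, (x + e)%R]%classic)%E) ->
  (upper_local_dim mu x <= (ln k / ln q)%:E)%E.
Proof.
move=> C0 t0 /andP[k0 k1] /andP[q0 q1] Hmu.
have lnq : ln q < 0 by rewrite ln_lt0// q0.
have lnk : ln k <= 0 by rewrite ln_le0.
set B := ln k / ln q.
pose K := ln C + ln k - ln t * B.
apply/lee_addgt0Pr => delta delta0.
rewrite /upper_local_dim limf_esupE.
(* [1] makes [ln e] negative, [t] makes the exponent [X] below nonnegative, and the last term gives
   [|K| <= delta * |ln e|]. *)
pose e0 := Num.min (Num.min 1 t) (expR (- `|K| / delta)).
have e00 : 0 < e0 by rewrite !lt_min ltr01 t0 expR_gt0.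
(* The upper limit is an infimum of suprema over neighbourhoods; one neighbourhood is enough. *)
apply: ge_ereal_inf.
exists (ereal_sup
    ((fun e => lne (mu `[(x - e)%R, (x + e)%R]%classic) / (ln e)%:E)%E @`
       [set e | 0 < e < e0])).
  exists [set e | 0 < e < e0] => //.
  near=> e; apply/andP; split; near: e.
    exact: nbhs_right_gt.
  exact: nbhs_right_lt.
apply: ge_ereal_sup => _ [e /= /andP[epos elt] <-].
move: elt; rewrite !lt_min => /andP[/andP[e1 et] eK].
have lne0 : ln e < 0 by rewrite ln_lt0// epos.
have elnK : ln e * delta <= - `|K|.
  by rewrite -ler_pdivlMr// -ler_expR lnK ?posrE// ltW.
(* [X] is the real solution of [q ^ X * t = e]; rounding it up to [N] keeps the radius at most [e]
   and costs at most one factor [k]. *)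
pose X := (ln e - ln t) / ln q.
have X0 : 0 <= X.
  by rewrite mulr_le0// ?invr_le0 ?(ltW lnq)// subr_le0 ler_ln ?posrE// ltW.
pose N := (Num.truncn X).+1.
have XN : X < N%:R by exact: truncnS_gt.
have NX : N%:R <= X + 1.
  by rewrite /N -natr1 lerD2r; have /andP[] := truncn_itv X0.
have qN : q ^+ N * t <= e.
  rewrite -ler_ln ?posrE ?mulr_gt0 ?exprn_gt0// lnM ?posrE ?exprn_gt0//.
  rewrite lnXn// -mulr_natr -lerBrDr mulrC -ler_ndivrMr//.
  exact: ltW.
have CkN : 0 < C * k ^+ N by rewrite mulr_gt0 ?exprn_gt0.
have := Hmu _ _ qN.
have : (mu `[(x - e)%R, (x + e)%R]%classic <= 1)%E by exact: probability_le1.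
have : (0 <= mu `[(x - e)%R, (x + e)%R]%classic)%E by exact: measure_ge0.
case: (mu _) => [v| |] //; rewrite !lee_fin => v0 v1 Cv.
have vpos : 0 < v by exact: lt_le_trans Cv.
rewrite lne_EFin// inver lt_eqF// -EFinM -EFinD lee_fin.
rewrite ler_ndivrMr//.
apply: le_trans (_ : ln (C * k ^+ N) <= _); last by rewrite ler_ln ?posrE.
rewrite lnM ?posrE ?exprn_gt0// lnXn// -mulr_natl.
apply: le_trans (_ : K + ln e * B <= _).
  rewrite mulrDl addrC [B * _]mulrC lerD2r mulrC.
  by apply: (le_trans elnK); rewrite lerNl -normrN ler_norm.
have -> : K + ln e * B = ln C + (X + 1) * ln k.
  have -> : (X + 1) * ln k = (ln e - ln t) * B + ln k.
    by rewrite mulrDl mul1r /X /B mulrAC mulrA.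
  by rewrite /K; ring.
by rewrite lerD2l ler_wnM2r.
Unshelve. all: by end_near.
Qed.

Theorem theorem4p1 (R : realType) (m : nat) (rho : R) (d p : 'I_m.+1 -> R)
    (mu : probability (measurableTypeR R) R) (a b : R) (n : nat) (k : R)
    (m_ge1 : (1 <= m)%N) (rho_gt0 : 0 < rho) (rho_lt1 : rho < 1)
    (d_first : d ord0 = 0) (d_last : d ord_max = 1 - rho)
    (d_incr : forall i j : 'I_m.+1, (i < j)%N -> d i < d j)
    (d_gap : forall i j : 'I_m.+1, (j = i.+1 :> nat) -> d j - d i <= rho)
    (p_gt0 : forall j : 'I_m.+1, 0 < p j)
    (p_sum1 : \sum_(j < m.+1) p j = 1)
    (mu_ss : self_similar rho d p mu)
    (a_lt_b : a < b)
    (I_sub : `]a, b[%classic `<=` `[0, 1]%classic)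
    (I_cover : forall x : R, 0 < x < 1 ->
       exists s : seq 'I_m.+1, (sim_word rho d s @` `]a, b[%classic) x)
    (n_ge1 : (1 <= n)%N)
    (k_min : is_minimum
       [set words_mass rho d p n x `]a, b[%classic | x in `]a, b[%classic] k) :
  forall x : R, 0 < x < 1 ->
    (upper_local_dim mu x <= lne k%:E / (n%:R * ln rho)%:E)%E.
Proof.
move=> x x01.
have w0 (s : seq 'I_m.+1) : 0 < weight p s by apply: prodr_gt0 => i _.
have lnrho : n%:R * ln rho < 0 by rewrite pmulr_rlt0 ?ltr0n// ln_lt0// rho_gt0.
have [[x0 _ kE] klb] := k_min.
have k_ge0 : 0 <= k by rewrite -kE sumr_ge0// => s _; exact: ltW.
have [k0|k_neq0] := eqVneq k 0.
  rewrite k0 le0_lneNy// inver lt_eqF// mulNyr sgrV ltr0_sg// mulN1e.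
  exact: leey.
have kpos : 0 < k by rewrite lt_neqAle eq_sym k_neq0.
(* [k] is a partial sum of the weights of all words of length [n], whose total is the mass 1 of the
   whole line. *)
have k_le1 : k <= 1.
  have : 1%E = (\sum_(s : n.-tuple 'I_m.+1) weight p s)%:E :> \bar R.
    rewrite -(probability_setT mu)
      (self_similar_iter _ _ _ _ _ _ p_gt0 mu_ss n)//.
    rewrite -sumEFin; apply: eq_bigr => s _.
    by rewrite preimage_setT probability_setT mule1.
  move=> [->]; rewrite -kE /words_mass.
  rewrite [leRHS](bigID (mem (words rho d n x0 `]a, b[))) /=.
  by rewrite lerDl sumr_ge0// => s _; exact: ltW.
have [t t1 tpos] := exists_itv_measure_gt0 _ mu.
pose c := fine (mu `[(- t)%R, t]%classic).
have cE : c%:E = mu `[(- t)%R, t]%classic by rewrite fineK// fin_num_measure.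
have c0 : 0 < c by rewrite -lte_fin cE.
have [s [y Iy yx]] := I_cover x x01.
have cI z r : `]a, b[%classic z -> t + t <= r ->
    (c%:E <= mu `[(z - r)%R, (z + r)%R]%classic)%E.
  move=> /I_sub; rewrite /= in_itv /= => /andP[z0 z1] tr.
  rewrite cE; apply: le_measure; rewrite ?inE//.
  by move=> u /=; rewrite !in_itv /= => /andP[? ?]; apply/andP; split; lra.
have lower := self_similar_itv_ge _ _ _ _ _ _ `]a, b[%classic n k c (t + t)
  rho_gt0 p_gt0 mu_ss k_ge0 (ltW c0)
  (fun z Iz => klb _ (ex_intro2 _ _ z Iz erefl))
  cI.
have -> : (lne k%:E / (n%:R * ln rho)%:E)%E = (ln k / ln (rho ^+ n))%:E.
  by rewrite lne_EFin// inver lt_eqF// lnXn// mulr_natl.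
(* Keeping only the word [s] that sends [y] to [x] costs a factor [weight p s] in mass and
   [rho ^+ size s] in radius. *)
apply: (upper_local_dim_le _ _ _ (weight p s * c) (rho ^+ size s * (t + t))).
- by rewrite mulr_gt0.
- by rewrite mulr_gt0 ?exprn_gt0//; lra.
- by rewrite kpos.
- by rewrite exprn_gt0// exprn_ilt1// ?ltW// -lt0n.
move=> N e Ne.
rewrite (self_similar_iter _ _ _ _ _ _ p_gt0 mu_ss (size s))//.
have q0 : 0 < rho ^+ size s by rewrite exprn_gt0.
have Q0 : 0 < (rho ^+ n) ^+ N by rewrite !exprn_gt0.
(* The map of [s] carries the interval of radius [(rho ^+ n) ^+ N * r] around [y] onto that of
   radius [e] around [x]; [Ne] says that [r] is at least [t + t]. *)
pose r := e / (rho ^+ size s * (rho ^+ n) ^+ N).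
have tr : t + t <= r.
  by rewrite ler_pdivlMr ?mulr_gt0// mulrC -mulrA mulrCA.
have eE : e = rho ^+ size s * ((rho ^+ n) ^+ N * r).
  by rewrite mulrA mulrC divfK// mulf_neq0 ?gt_eqF.
rewrite (bigD1 (in_tuple s))// eE -yx.
rewrite -[sim_word rho d s y]/(sim_word rho d (in_tuple s) y).
rewrite sim_word_preimage_itv//.
rewrite -[leLHS]adde0; apply: leeD.
  rewrite -mulrA EFinM lee_wpmul2l//; first by rewrite lee_fin ltW.
  exact: lower.
by apply: sume_ge0 => u _; rewrite mule_ge0// lee_fin ltW.
Qed.
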